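(* Let $u_*\in(0,1)$ and $\theta_0\neq\theta_1$ in $\Theta$, and suppose that for each $n$ the random variables $X_1,\ldots,X_n$ are independent with $X_k\sim P_{\theta_0}$ for $k\le [u_*n]$ and $X_k\sim P_{\theta_1}$ for $[u_*n]<k\le n$ (the alternative $H_1$). Assume $E_{\theta_i}[\|\psi(X)\|^2]<\infty$ for $i=0,1$. Define $\Sigma_*=u_*\Sigma(\theta_0)+(1-u_* )\Sigma(\theta_1)$, assume $\Sigma_*$ is invertible, and let $\lambda_*$ be the smallest eigenvalue of $\Sigma_*^{-1}$. Assume that $\lambda_*>0$ and $\|e(\theta_0)-e(\theta_1)\|>0$. Then the test based on the statistic $$\mathcal{T}_n=n\sup_{u\in[0,1]}\left|\mathbb{Z}_n(u,\widehat\theta_n)^\top\,\widehat\Sigma_n^{-1}\,\mathbb{Z}_n(u,\widehat\theta_n)\right|$$ is consistent: for every fixed critical value $c>0$, the probability under $H_1$ that $\mathcal{T}_n>c$ tends to $1$ as $n\to\infty$.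
   Context: Let $\Theta\subset\mathbb{R}^d$ be bounded, open and convex, and let $\{P_\theta:\theta\in\Theta\}$ be a family of probability distributions on a measurable space $(\mathcal{X},\mathcal{A})$ with densities $f(\cdot;\theta)$ with respect to a measure $\mu$. Let $\psi:\mathcal{X}\to\mathbb{R}^d$ be measurable. With $X\sim P_\theta$ under $E_\theta$, put $e(\theta)=E_\theta[\psi(X)]\in\mathbb{R}^d$ (assumed to exist and to be differentiable on $\Theta$) and $\Sigma(\theta)=E_\theta[(\psi(X)-e(\theta))(\psi(X)-e(\theta))^\top]$. For $u\in[0,1]$ and $\theta\in\Theta$, $$\mathbb{Z}_n(u,\theta)=\frac1n\sum_{k=1}^{[un]}(\psi(X_k)-e(\theta)),$$ where $[\cdot]$ is the integer part. The method of moments estimator $\widehat\theta_n$ is a $\Theta$-valued random vector solving $\mathbb{Z}_n(1,\widehat\theta_n)=0$, i.e. $e(\widehat\theta_n)=\frac1n\sum_{k=1}^n\psi(X_k)$; it is assumed that such a solution exists almost surely for all sufficiently large $n$. Also $$\widehat\Sigma_n=\frac1n\sum_{k=1}^n(\psi(X_k)-e(\widehat\theta_n))(\psi(X_k)-e(\widehat\theta_n))^\top .$$ On the event that $\widehat\Sigma_n$ is singular, $\widehat\Sigma_n^{-1}$ is given an arbitrary value (e.g. the zero matrix). $\|\cdot\|$ is the Euclidean norm. The test of ''no change in the parameter'' rejects when $\mathcal{T}_n$ exceeds a fixed critical value (the upper quantile of the null limit distribution at the chosen level). *)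

(* Defs.v *)
From HB Require Import structures.
From mathcomp Require Import all_boot all_order all_algebra.
From mathcomp Require Import all_classical all_reals all_analysis.

Set Implicit Arguments.
Unset Strict Implicit.
Unset Printing Implicit Defensive.

Import Order.TTheory GRing.Theory Num.Theory.
Import numFieldNormedType.Exports.

Local Open Scope classical_set_scope.
Local Open Scope ring_scope.

(* The library norm on matrices is the sup norm; it is equivalent to this one,
   so [open], [bounded_set] and [differentiable] have their usual meaning. *)
Definition enorm (R : realType) (d : nat) (v : 'cV[R]_d) : R :=
  Num.sqrt (\sum_(i < d) v i 0 ^+ 2).

Definition borel_measurable (dT : measure_display) (T : measurableType dT)
    (V : ptopologicalType) (f : T -> V) : Prop :=
  measurable_fun [set: T] (f : T -> g_sigma_algebraType (@open V)).

Definition is_density (dT : measure_display) (T : measurableType dT)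
    (R : realType) (mu : {measure set T -> \bar R}) (Q : probability T R)
    (f : T -> R) : Prop :=
  [/\ measurable_fun [set: T] f, (forall x, 0 <= f x) &
      forall A, measurable A -> Q A = (\int[mu]_(x in A) (f x)%:E)%E].

Definition mutually_independent (dO dT : measure_display)
    (Omega : measurableType dO) (T : measurableType dT) (R : realType)
    (Pr : probability Omega R) (I : finType) (X : I -> {RV Pr >-> T}) : Prop :=
  forall (J : {set I}) (A : I -> set T), (forall k, measurable (A k)) ->
    Pr (\bigcap_(k in [set` J]) (X k @^-1` A k)) =
    (\prod_(k in J) Pr (X k @^-1` A k))%E.

Definition smallest_eigenvalue (R : realType) (d : nat) (A : 'M[R]_d) (a : R) :
    Prop :=
  eigenvalue A a /\ (forall b, eigenvalue A b -> a <= b).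

Section Moments.
Variables (R : realType) (d : nat) (dT : measure_display).
Variables (T : measurableType dT) (P : 'cV[R]_d -> probability T R).
Variable psi : T -> 'cV[R]_d.

Definition mean_vec (theta : 'cV[R]_d) : 'cV[R]_d :=
  \col_i fine 'E_(P theta)[fun x => psi x i 0].

Definition cov_mx (theta : 'cV[R]_d) : 'M[R]_d :=
  \matrix_(i, j) fine 'E_(P theta)[fun x =>
    ((psi x - mean_vec theta) *m (psi x - mean_vec theta)^T) i j].

(* A sample X_1, ..., X_n is a function on 'I_n whose value at k is X_{k+1},
   so the summation range k <= [u n] becomes k < [u n]. *)
Definition Zn (n : nat) (x : 'I_n -> T) (u : R) (theta : 'cV[R]_d) : 'cV[R]_d :=
  n%:R^-1 *:
    \sum_(k < n | (k < Num.truncn (u * n%:R))%N) (psi (x k) - mean_vec theta).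

Definition Sigma_hat (n : nat) (x : 'I_n -> T) (theta : 'cV[R]_d) : 'M[R]_d :=
  n%:R^-1 *:
    \sum_(k < n) (psi (x k) - mean_vec theta) *m (psi (x k) - mean_vec theta)^T.

(* [W] is the value given to the inverse of a singular matrix. *)
Definition inv_or (W A : 'M[R]_d) : 'M[R]_d :=
  if A \in unitmx then invmx A else W.

(* The supremum runs over a nonempty finite set of values, because
   [Zn x u theta] depends on u only through [u n]. *)
Definition Tn (n : nat) (W : 'M[R]_d) (x : 'I_n -> T) (theta : 'cV[R]_d) : R :=
  n%:R * sup [set `| ((Zn x u theta)^T *m inv_or W (Sigma_hat x theta)
                        *m Zn x u theta) 0 0 | | u in `[0, 1]%classic].

End Moments.

(* Main.v *)
Require Import Defs.
From HB Require Import structures.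
From mathcomp Require Import all_boot all_order all_algebra.
From mathcomp Require Import all_classical all_reals all_analysis.
From mathcomp Require Import measurable_realfun ring lra.
Set Implicit Arguments.
Unset Strict Implicit.
Unset Printing Implicit Defensive.
Import Order.TTheory GRing.Theory Num.Theory.
Import numFieldNormedType.Exports.
Local Open Scope classical_set_scope.
Local Open Scope ring_scope.

(* On the event that the estimator solves its equation, its mean vector is the
   empirical mean of [psi], so the coordinate [i] of [Z_n(u*, theta_hat)] is a
   weighted sum of the [psi_i(X_k)]; it converges in probability to
   [u* (1 - u* ) (e(theta_0) - e(theta_1))_i], which is nonzero for some [i].
   By Cauchy-Schwarz, [z^T S^-1 z >= z_i^2 / S_ii] for [S = Sigma_hat]
   invertible, and [S_ii] is at most the empirical mean of [psi_i^2], which is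
   smaller than [n delta] with probability tending to 1 by Markov's inequality.

   It remains to see that [Sigma_hat] is invertible with probability tending to
   1, since the value substituted for the inverse is arbitrary otherwise. If
   [Sigma_hat] is singular, the points [psi(X_k)] lie on an affine hyperplane,
   so that the Gram matrix of the vectors [(1, psi(X_k))], rescaled to have
   bounded entries, is singular. This Gram matrix obeys Chebyshev's inequality,
   and its limit is nonsingular: a kernel vector would give an affine hyperplane
   supporting the laws of [psi] under both parameters, hence a kernel vector of
   [Sigma_star]. *)

(** * Gram matrices *)

Lemma sum_sqr_eq0 (R : realDomainType) (I : finType) (u : I -> R) :
  \sum_k u k ^+ 2 = 0 -> forall k, u k = 0.
Proof.
move=> /psumr_eq0P u0 k; apply/eqP; rewrite -sqrf_eq0; apply/eqP.
by apply: u0 => // i _; exact: sqr_ge0.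
Qed.

(** Cauchy-Schwarz for finite sums. The squares of [a * v k - b * u k] sum to
    [a * (a * c - b ^+ 2)], so dividing by [a > 0] gives the bound; if [a = 0], all [u k] vanish. *)
Lemma sum_mul_le (R : realFieldType) (I : finType) (u v : I -> R) :
  (\sum_k u k * v k) ^+ 2 <= (\sum_k u k ^+ 2) * (\sum_k v k ^+ 2).
Proof.
set a := \sum_k u k ^+ 2; set b := \sum_k u k * v k; set c := \sum_k v k ^+ 2.
have a0 : 0 <= a by apply: sumr_ge0 => k _; exact: sqr_ge0.
have [/esym a_eq0|a_gt0] := eqVneq 0 a.
  have u0 := sum_sqr_eq0 a_eq0.
  by rewrite a_eq0 mul0r /b big1 ?expr0n// => k _; rewrite u0 mul0r.
have {}a_gt0 : 0 < a by rewrite lt_def eq_sym a_gt0.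
have : 0 <= \sum_k (a * v k - b * u k) ^+ 2.
  by apply: sumr_ge0 => k _; exact: sqr_ge0.
have -> : \sum_k (a * v k - b * u k) ^+ 2 = a * (a * c - b ^+ 2).
  under eq_bigr => k _.
    rewrite (_ : _ ^+ 2 = a ^+ 2 * v k ^+ 2 - 2 * a * b * (u k * v k)
                          + b ^+ 2 * u k ^+ 2); last by ring.
    over.
  rewrite big_split sumrB/= -!mulr_sumr -/a -/b -/c.
  by ring.
by rewrite pmulr_rge0// subr_ge0.
Qed.

Section gram.
Context {R : realFieldType} {I : finType} {d : nat}.
Variables (a : R) (phi : I -> 'cV[R]_d).
Let S := a *: \sum_k phi k *m (phi k)^T.

Lemma gramE i j : S i j = a * \sum_k phi k i 0 * phi k j 0.
Proof.
rewrite /S mxE summxE; congr (_ * _); apply: eq_bigr => k _.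
by rewrite mxE big_ord1 !mxE.
Qed.

Lemma trmx_gram : S^T = S.
Proof.
by apply/matrixP => i j; rewrite mxE !gramE; congr (_ * _); apply: eq_bigr => k _;
  rewrite mulrC.
Qed.

Lemma gram_form (y z : 'cV[R]_d) :
  (y^T *m S *m z) 0 0 = a * \sum_k ((y^T *m phi k) 0 0 * (z^T *m phi k) 0 0).
Proof.
rewrite /S -scalemxAr -scalemxAl mxE; congr (_ * _).
rewrite mulmx_sumr mulmx_suml summxE; apply: eq_bigr => k _.
rewrite mulmxA -(mulmxA _ (phi k)^T z) [LHS]mxE big_ord1; congr (_ * _).
by rewrite -[in RHS](trmxK (phi k)) -trmx_mul [RHS]mxE.
Qed.

(** The value of the form at [v] is [a] times a sum of squares, and it vanishes when [v] is in the
    kernel. *)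
Lemma gram_singular (v : 'cV[R]_d) : 0 < a -> S *m v = 0 ->
  forall k, (v^T *m phi k) 0 0 = 0.
Proof.
move=> a_gt0 Sv0; apply: sum_sqr_eq0; apply: (mulfI (lt0r_neq0 a_gt0)).
rewrite mulr0; under eq_bigr do rewrite expr2.
by rewrite -gram_form -mulmxA Sv0 mulmx0 mxE.
Qed.

(* Cauchy-Schwarz for the form of [S]: with [z = S y], the coordinate [z_i] is
   the pairing of [e_i] with [y]. *)
Lemma sqr_le_gram_invmx (z : 'cV[R]_d) i : S \in unitmx ->
  z i 0 ^+ 2 <= S i i * (z^T *m invmx S *m z) 0 0.
Proof.
move=> Su; set y := invmx S *m z.
have zE : z = S *m y by rewrite /y mulKVmx.
have -> : (z^T *m invmx S *m z) 0 0 = a * \sum_k ((y^T *m phi k) 0 0) ^+ 2.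
  under eq_bigr do rewrite expr2.
  rewrite -gram_form -mulmxA -/y [in LHS]zE trmx_mul trmx_gram.
  by rewrite mulmxA.
have -> : z i 0 = a * \sum_k (phi k i 0 * (y^T *m phi k) 0 0).
  have -> : z i 0 = ((delta_mx i (0 : 'I_1))^T *m S *m y) 0 0.
    by rewrite -mulmxA -zE trmx_delta -rowE mxE.
  rewrite gram_form; congr (_ * _); apply: eq_bigr => k _; congr (_ * _).
  by rewrite trmx_delta -rowE mxE.
rewrite gramE exprMn [leRHS]mulrACA -[a * a]expr2 ler_wpM2l ?sqr_ge0//.
under [X in _ <= X * _]eq_bigr do rewrite -expr2.
exact: sum_mul_le.
Qed.

End gram.

(* A common affine hyperplane [v x = v m] containing all the [x k] is a linear
   hyperplane containing the vectors proportional to [(1, x k)]. *)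
Lemma gram_affine_singular (R : realFieldType) (I : finType) (d : nat)
    (a b : R) (x : I -> 'cV[R]_d) (m : 'cV[R]_d) (s : I -> R) :
  0 < a ->
  a *: \sum_k (x k - m) *m (x k - m)^T \notin unitmx ->
  \det (b *: \sum_k (s k *: col_mx 1%:M (x k) : 'cV_(1 + d))
                 *m (s k *: col_mx 1%:M (x k))^T) = 0.
Proof.
move=> a_gt0; set S := a *: _; rewrite unitmxE unitfE negbK => /eqP detS.
have /eqP/det0P[v v0 vS] : \det S^T = 0 by rewrite det_tr.
have Sv : S *m v^T = 0 by apply: trmx_inj; rewrite trmx_mul trmxK vS trmx0.
have vx k : v *m (x k - m) = 0.
  by apply/matrixP => i j; rewrite !ord1 -[v in LHS]trmxK (gram_singular a_gt0 Sv) mxE.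
(* The pairing of this row with [(1, x k)] is [v (x k - m)], which is zero; the row is nonzero
   because its right block is [v]. *)
apply/eqP/det0P; exists (row_mx (- (v *m m)) v).
  by apply: contraNneq v0 => /(congr1 rsubmx); rewrite row_mxKr linear0 => ->.
rewrite -scalemxAr mulmx_sumr big1 ?scaler0// => k _.
rewrite mulmxA -scalemxAr mul_row_col mulmx1.
by rewrite addrC -mulmxBr vx scaler0 mul0mx.
Qed.

(** * Variances of sums of independent variables *)

Section second_moments.
Context {R : realType} {d : measure_display} {T : measurableType d}.
Variable P : probability T R.
Local Open Scope ereal_scope.

Lemma Lfun2_sqr_lty (Y : T -> R) : measurable_fun [set: T] Y ->
  'E_P[fun x => (Y x ^+ 2)%R] < +oo -> Y \in Lfun P 2%:E.
Proof.
move=> mY; rewrite unlock => Y2; rewrite inE/=; apply/andP; split; rewrite inE//=.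
rewrite /finite_norm unlock poweR_lty//.
by under eq_integral => x _ do rewrite poweR_EFin powR_mulrn// -normrX ger0_norm ?sqr_ge0//.
Qed.

Lemma Lfun2_Lfun1 (Y : T -> R) : Y \in Lfun P 2%:E -> Y \in Lfun P 1.
Proof. by apply: Lfun_subset12; exact: fin_num_measure. Qed.

Lemma Lfun2_sum (I : Type) (s : seq I) (Y : I -> T -> R) :
  (forall i, Y i \in Lfun P 2%:E) -> (\sum_(i <- s) Y i)%R \in Lfun P 2%:E.
Proof. by move=> Y2; apply: rpred_sum => //; rewrite lee1n. Qed.

Lemma covariance_sumr0 (I : eqType) (s : seq I) (Y : I -> T -> R) (Z : T -> R) :
  (forall i, Y i \in Lfun P 2%:E) -> Z \in Lfun P 2%:E ->
  (forall i, i \in s -> covariance P Z (Y i) = 0) ->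
  covariance P Z (\sum_(i <- s) Y i)%R = 0.
Proof.
move=> Y2 Z2; elim: s => [|i s IH] cov0.
  by rewrite big_nil; exact: covariance_cst_r.
rewrite big_cons covarianceDr ?Lfun2_sum// cov0 ?mem_head// IH ?adde0// => j js.
by apply: cov0; rewrite in_cons js orbT.
Qed.

Lemma variance_sum_uncorrelated (I : eqType) (s : seq I) (Y : I -> T -> R) :
  uniq s -> (forall i, Y i \in Lfun P 2%:E) ->
  (forall i j, i != j -> covariance P (Y i) (Y j) = 0) ->
  'V_P[(\sum_(i <- s) Y i)%R] = \sum_(i <- s) 'V_P[Y i].
Proof.
move=> us Y2 cov0; elim: s us => [|i s IH] /=.
  by move=> _; rewrite !big_nil; exact: variance_cst.
move=> /andP[si us]; rewrite !big_cons varianceD ?Lfun2_sum// IH//.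
rewrite covariance_sumr0 ?mule0 ?adde0// => j js.
by apply: cov0; apply: contraNneq si => ->.
Qed.

Lemma fine_expectation_sum (I : Type) (s : seq I) (Y : I -> T -> R) :
  (forall i, Y i \in Lfun P 1) ->
  fine 'E_P[(\sum_(i <- s) Y i)%R] = (\sum_(i <- s) fine 'E_P[Y i])%R.
Proof.
move=> Y1; elim: s => [|i s IH].
  by rewrite !big_nil expectation_cst.
have Ys : (\sum_(i <- s) Y i)%R \in Lfun P 1 by exact: rpred_sum.
by rewrite !big_cons expectationD// fineD ?expectation_fin_num// IH.
Qed.

(** Without correlations the variance of the weighted sum is the sum of the [a i ^+ 2 * V[Y i]], and
    each variance is at most the second moment, hence at most [C]. *)
Lemma chebyshev_uncorrelated (I : finType) (Y : I -> T -> R) (a : I -> R) (C eps : R) :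
  (forall i, Y i \in Lfun P 2%:E) ->
  (forall i j, i != j -> covariance P (Y i) (Y j) = 0) ->
  (forall i, 'E_P[fun x => (Y i x ^+ 2)%R] <= C%:E) -> (0 < eps)%R ->
  P [set x | (eps <= `| \sum_i a i * Y i x - \sum_i a i * fine 'E_P[Y i] |)%R]
    <= (eps ^- 2 * (C * \sum_i a i ^+ 2))%:E.
Proof.
move=> Y2 cov0 YC eps0.
have aY2 i : (a i \o* Y i)%R \in Lfun P 2%:E by rewrite Lfun_scale// ler1n.
have aYE : (\sum_i a i \o* Y i)%R = (fun x => \sum_i a i * Y i x)%R.
  by apply/funext => x; rewrite fct_sumE; apply: eq_bigr => i _ /=; rewrite mulrC.
have mS : measurable_fun [set: T] (\sum_i a i \o* Y i)%R.
  have := @Lfun2_sum _ (index_enum I) _ aY2.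
  by rewrite inE => /andP[+ _]; rewrite inE.
(* [chebyshev] takes a bundled random variable, so the sum is packed with its measurability
   proof. *)
pose S := HB.pack_for {mfun T >-> R} (\sum_i a i \o* Y i)%R
  (isMeasurableFun.Build _ _ _ _ _ mS).
have := @chebyshev _ _ _ P S _ eps0.
have -> : fine 'E_P[S] = (\sum_i a i * fine 'E_P[Y i])%R.
  rewrite fine_expectation_sum => [|i]; last exact: Lfun2_Lfun1.
  apply: eq_bigr => i _; rewrite expectationZl ?Lfun2_Lfun1//.
  by rewrite fineM// expectation_fin_num// Lfun2_Lfun1.
move=> /le_trans-/(_ ((eps ^- 2)%:E * (C * \sum_i a i ^+ 2)%:E)); rewrite -EFinM.
rewrite [X in P X](_ : _ = [set x | (eps <= `| \sum_i a i * Y i x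
                                      - \sum_i a i * fine 'E_P[Y i] |)%R]).
  apply; rewrite EFinM lee_wpmul2l ?lee_fin ?invr_ge0 ?sqr_ge0//.
  rewrite variance_sum_uncorrelated ?index_enum_uniq//; last first.
    move=> i j ij; have Yi1 := Lfun2_Lfun1 (Y2 i); have Yj1 := Lfun2_Lfun1 (Y2 j).
    rewrite covarianceZl//; last 2 first.
    - exact: Lfun2_Lfun1.
    - exact: (Lfun2_mul_Lfun1 (Y2 i) (aY2 j)).
    by rewrite covarianceZr ?cov0 ?mule0// (Lfun2_mul_Lfun1 (Y2 i) (Y2 j)).
  rewrite mulr_sumr -sumEFin; apply: lee_sum => i _.
  rewrite varianceZ// (mulrC C) (EFinM (a i ^+ 2)) lee_wpmul2l ?lee_fin ?sqr_ge0//.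
  rewrite varianceE//; apply: le_trans (YC i).
  rewrite leeBlDr; last by rewrite fin_numX// expectation_fin_num// Lfun2_Lfun1.
  by rewrite leeDl// expe2 sqre_ge0.
by apply: eq_set => x; rewrite [S x](congr1 (@^~ x) aYE).
Qed.

End second_moments.

(** * Independence: factorisation of expectations and Chebyshev's inequality *)

Section independence.
Context {R : realType} {dO dT : measure_display}.
Context {Omega : measurableType dO} {T : measurableType dT}.
Variable Pr : probability Omega R.
Local Open Scope ereal_scope.

Lemma independent_preimageI (I : finType) (X : I -> {RV Pr >-> T}) (i j : I)
    (A B : set T) :
  mutually_independent X -> i != j -> measurable A -> measurable B ->
  Pr (X i @^-1` A `&` X j @^-1` B) = Pr (X i @^-1` A) * Pr (X j @^-1` B).
Proof.
move=> indX ij mA mB.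
(* Joint independence is specialised to the index set [{i, j}]; the value [B] of [C] outside [i]
   matters only at [j]. *)
pose C k := if k == i then A else B.
have := indX [set i; j]%SET C (fun k => _).
rewrite big_setU1 ?inE//= big_set1 /C eqxx eq_sym (negbTE ij) => <-; last first.
  by move=> k; case: ifP.
congr (Pr _); apply/seteqP; split=> [w [wA wB] k /=|w wAB].
  by rewrite !inE => /orP[] /eqP ->; rewrite ?eqxx// eq_sym (negbTE ij).
have := wAB i; have := wAB j; rewrite /= eqxx eq_sym (negbTE ij) !inE !eqxx orbT.
by move=> /(_ isT) ? /(_ isT).
Qed.

(** The law of the pair agrees with the product of the marginals on rectangles, hence everywhere;
    Fubini's theorem then splits the integral of the product. *)
Lemma expectation_mul_indep (I : finType) (X : I -> {RV Pr >-> T}) (i j : I)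
    (g : T -> R) :
  mutually_independent X -> i != j -> measurable_fun [set: T] g ->
  g \o X i \in Lfun Pr 2%:E -> g \o X j \in Lfun Pr 2%:E ->
  'E_Pr[(g \o X i) \* (g \o X j)] = 'E_Pr[g \o X i] * 'E_Pr[g \o X j].
Proof.
move=> indX ij mg gi2 gj2.
have gi1 := Lfun2_Lfun1 gi2; have gj1 := Lfun2_Lfun1 gj2.
pose XY := fun w => (X i w, X j w).
have mXY : measurable_fun [set: Omega] XY.
  by apply/measurable_fun_pairP; split; exact: measurable_funPT.
pose G (z : T * T) : \bar R := (g z.1 * g z.2)%:E.
have mG : measurable_fun setT G.
  apply/measurable_EFinP; apply: measurable_funM; apply: measurableT_comp => //.
pose joint := (distribution Pr (X i) \x distribution Pr (X j)).
have jointE A : measurable A -> joint A = pushforward Pr XY A.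
  move=> mA; pose XYm := HB.pack_for {mfun Omega >-> (T * T)%type} XY
    (isMeasurableFun.Build _ _ _ _ _ mXY).
  rewrite -[RHS]/(distribution Pr XYm A); apply: product_measure_unique => // B C mB mC.
  by rewrite -independent_preimageI.
have iG : Pr.-integrable [set: Omega] (G \o XY).
  by have /Lfun1_integrable := Lfun2_mul_Lfun1 gi2 gj2.
have iGp : (pushforward Pr XY).-integrable [set: T * T] G by exact: integrable_pushforward.
(* Fubini's theorem asks for integrability under the product measure; it is carried over from the
   law of the pair. *)
have iGj : joint.-integrable [set: T * T] G.
  apply/integrableP; split => //.
  rewrite (eq_measure_integral (pushforward Pr XY)) => [|A mA _]; last exact: jointE.
  by case/integrableP : iGp.
have gX k : g \o X k \in Lfun Pr 1 ->
    \int[distribution Pr (X k)]_x (g x)%:E = 'E_Pr[g \o X k].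
  move=> /Lfun1_integrable gk; rewrite unlock integral_distribution//.
  exact/measurable_EFinP.
have iX k : g \o X k \in Lfun Pr 1 ->
    (distribution Pr (X k)).-integrable [set: T] (EFin \o g).
  move=> /Lfun1_integrable gk; apply: integrable_pushforward => //.
  exact/measurable_EFinP.
transitivity (\int[Pr]_w (G \o XY) w); first by rewrite unlock.
rewrite -[LHS](@integral_pushforward _ _ _ _ _ XY mXY Pr setT G mG iG)//.
rewrite (eq_measure_integral joint) => [|A mA _]; last first.
  by apply/esym; exact: jointE.
rewrite -integral12_prod_meas1//= /fubini_F /G/=.
under eq_integral => x _.
  under eq_integral => y _ do rewrite EFinM.
  rewrite integralZl//; last exact: iX.
  rewrite gX//.
  over.
rewrite -(fineK (expectation_fin_num gj1)) integralZr//; last exact: iX.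
by rewrite gX.
Qed.

Lemma chebyshev_indep (I : finType) (X : I -> {RV Pr >-> T}) (g : T -> R)
    (a : I -> R) (C eps : R) :
  mutually_independent X -> measurable_fun [set: T] g ->
  (forall i, 'E_Pr[fun w => (g (X i w) ^+ 2)%R] <= C%:E) -> (0 < eps)%R ->
  Pr [set w | (eps <= `| \sum_i a i * g (X i w)
                         - \sum_i a i * fine 'E_Pr[g \o X i] |)%R]
    <= (eps ^- 2 * (C * \sum_i a i ^+ 2))%:E.
Proof.
move=> indX mg gC eps0.
have g2 i : g \o X i \in Lfun Pr 2%:E.
  apply: Lfun2_sqr_lty; first exact: measurableT_comp.
  by rewrite (le_lt_trans (gC i))// ltry.
apply: (@chebyshev_uncorrelated _ _ _ Pr I (fun i => g \o X i)) => // i j ij.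
rewrite covarianceE ?Lfun2_mul_Lfun1 ?Lfun2_Lfun1//.
rewrite [X in X - _](expectation_mul_indep indX ij)// subee//.
by rewrite fin_numM ?expectation_fin_num ?Lfun2_Lfun1.
Qed.

End independence.

(** * Events of probability tending to 1 *)

Section with_high_probability.
Context {R : realType} {d : measure_display} {T : measurableType d}.
Variable P : probability T R.
Local Open Scope ereal_scope.

(** Phrasing the limit through complements turns intersections into union bounds. The measurability
    clause gives access to monotonicity and subadditivity of [P]. *)
Definition whp (A : nat -> set T) : Prop :=
  (forall n, measurable (A n)) /\ P (~` A n) @[n --> \oo] --> 0.

Lemma whp_cvg1 A : whp A -> P (A n) @[n --> \oo] --> 1.
Proof.
move=> [mA A0]; rewrite (_ : (fun n => P (A n)) = (fun n => 1 - P (~` A n))).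
  rewrite -[X in _ --> X]sube0; apply: cvgeB => //; exact: cvg_cst.
by apply/funext => n; rewrite -probability_setC ?setCK//; exact: measurableC.
Qed.

Lemma whp_ub (A : nat -> set T) (u : nat -> R) : (forall n, measurable (A n)) ->
  (\forall n \near \oo, P (~` A n) <= (u n)%:E) ->
  (u n @[n --> \oo] --> 0%R) -> whp A.
Proof.
move=> mA Au u0; split => //.
apply: (@squeeze_cvge _ _ _ _ (cst 0) _ (EFin \o u)).
- by near=> n; rewrite measure_ge0/=; near: n.
- exact: cvg_cst.
- by apply: cvg_EFin => //; exact: nearW.
Unshelve. all: by end_near. Qed.

Lemma whp_sub (A B : nat -> set T) : whp A -> (forall n, measurable (B n)) ->
  (\forall n \near \oo, A n `<=` B n) -> whp B.
Proof.
move=> [mA A0] mB AB; split => //.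
apply: (@squeeze_cvge _ _ _ _ (cst 0) _ (fun n => P (~` A n))) => //; last exact: cvg_cst.
near=> n; rewrite measure_ge0/= le_measure ?inE//; try exact: measurableC.
by apply: subsetC; near: n.
Unshelve. all: by end_near. Qed.

Lemma whpI (A B : nat -> set T) : whp A -> whp B -> whp (fun n => A n `&` B n).
Proof.
move=> [mA A0] [mB B0]; split; first by move=> n; exact: measurableI.
apply: (@squeeze_cvge _ _ _ _ (cst 0) _ (fun n => P (~` A n) + P (~` B n))).
- near=> n; rewrite measure_ge0/= setCI.
  by apply: measureU2; exact: measurableC.
- exact: cvg_cst.
- by rewrite -[X in _ --> X]adde0; exact: cvgeD.
Unshelve. all: by end_near. Qed.

Lemma whp_forall (I : finType) (A : I -> nat -> set T) :
  (forall i, whp (A i)) -> whp (fun n => [set x | forall i, A i n x]).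
Proof.
move=> whpA.
suff H (s : seq I) : whp (fun n => [set x | forall i, i \in s -> A i n x]).
  have := H (enum I); congr whp; apply/funext => n; apply/seteqP.
  by split=> x /= Ax i => [|_]; apply: Ax; rewrite ?mem_enum.
elim: s => [|i s IH].
  have -> : (fun n => [set x | forall i, i \in [::] -> A i n x]) = fun=> setT.
    by apply/funext => n; apply/seteqP; split.
  by split => //; rewrite setCT measure0; exact: cvg_cst.
have := whpI (whpA i) IH; congr whp; apply/funext => n; apply/seteqP; split=> x /=.
  by move=> [Ai As] j; rewrite in_cons => /orP[/eqP ->//|]; exact: As.
move=> Ax; split; first by apply: Ax; rewrite mem_head.
by move=> j js; apply: Ax; rewrite in_cons js orbT.
Qed.

(** The tail intersections [F k] increase to a set of probability 1, so [P (F k)] tends to 1 by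
    continuity from below, and [F n] is contained in [A n]. *)
Lemma whp_ae (A : nat -> set T) : (forall n, measurable (A n)) ->
  {ae P, forall x, \forall n \near \oo, A n x} -> whp A.
Proof.
move=> mA aeA; split => //.
pose F k := \bigcap_(n in [set n | (k <= n)%N]) A n.
have mF k : measurable (F k) by exact: bigcap_measurableType.
have mU : measurable (\bigcup_k F k) by exact: bigcupT_measurable.
have PU : P (\bigcup_k F k) = 1.
  rewrite -(setCK (\bigcup_k F k)) probability_setC; last exact: measurableC.
  rewrite (_ : P _ = 0) ?sube0//; case: aeA => N [mN N0 subN].
  apply: (subset_measure0 _ mN _ N0); first exact: measurableC.
  apply: subset_trans subN => x /= nUx [k _ Ak]; apply: nUx.
  by exists k => // n; exact: Ak.
have cF : P (F k) @[k --> \oo] --> 1.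
  rewrite -PU; apply: nondecreasing_cvg_mu => //.
  move=> k l kl; apply/subsetPset => x Fk n /= ln.
  by apply: Fk => /=; exact: leq_trans ln.
have cCF : P (~` F k) @[k --> \oo] --> 0.
  rewrite (_ : (fun k => P (~` F k)) = fun k => 1 - P (F k)).
    have <- : 1 - 1 = 0 :> \bar R by rewrite subee.
    by apply: cvgeB => //; exact: cvg_cst.
  by apply/funext => k; rewrite probability_setC.
apply: (@squeeze_cvge _ _ _ _ (cst 0) _ (fun k => P (~` F k))) => //; last exact: cvg_cst.
near=> n; rewrite measure_ge0/= le_measure ?inE//; try exact: measurableC.
by apply: subsetC => x; apply => /=.
Unshelve. all: by end_near. Qed.

End with_high_probability.

(** * Measurability *)

Section measurable_matrices.
Context {R : realType} {dO : measure_display} {T : measurableType dO}.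

Lemma measurable_fun_inv (f : T -> R) : measurable_fun [set: T] f ->
  measurable_fun [set: T] (fun x => (f x)^-1).
Proof.
(* For [f x] nonzero, [expR (- ln (f x ^+ 2))] is the inverse of [f x ^+ 2]; at a zero of [f] both
   sides are 0 by the convention on inverses. *)
move=> mf; rewrite (_ : (fun x => _) = (fun x => f x * expR (- ln (f x ^+ 2)))).
  apply: measurable_funM => //; apply: measurableT_comp => //.
  apply: measurableT_comp => //; apply: measurableT_comp; first exact: measurable_ln.
  exact: measurable_funX.
apply/funext => x; have [->|f0] := eqVneq (f x) 0; first by rewrite invr0 mul0r.
by rewrite expRN lnK ?posrE ?exprn_even_gt0//; field.
Qed.

(** The entrywise form passes through products, sums, determinants and inverses by closure
    properties of real-valued functions. Continuity of the coordinates derives it from Borel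
    measurability. *)
Definition mxmeasurable p q (F : T -> 'M[R]_(p, q)) : Prop :=
  forall i j, measurable_fun [set: T] (fun x => F x i j).

Lemma borel_mxmeasurable p q (F : T -> 'M[R]_(p, q)) :
  borel_measurable F -> mxmeasurable F.
Proof.
move=> mF i j; apply: (measurability _ (RGenOInfty.measurableE R)) => //.
move=> _ [_ [a ->] <-]; rewrite setTI.
rewrite -[X in measurable X]setTI.
pose U := (fun M : 'M[R]_(p, q) => M i j) @^-1` `]a, +oo[.
have oU : open U.
  apply: open_comp; last exact: interval_open.
  by move=> M _; exact: coord_continuous.
exact: (mF measurableT U (sub_gen_smallest oU)).
Qed.

Lemma mxmeasurableM p q r (F : T -> 'M[R]_(p, q)) (G : T -> 'M[R]_(q, r)) :
  mxmeasurable F -> mxmeasurable G -> mxmeasurable (fun x => F x *m G x).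
Proof.
move=> mF mG i j; under eq_fun do rewrite mxE.
by apply: measurable_sum => k; exact: measurable_funM.
Qed.

Lemma mxmeasurable_tr p q (F : T -> 'M[R]_(p, q)) :
  mxmeasurable F -> mxmeasurable (fun x => (F x)^T).
Proof. by move=> mF i j; under eq_fun do rewrite mxE; exact: mF. Qed.

Lemma mxmeasurable_cst p q (A : 'M[R]_(p, q)) : mxmeasurable (fun=> A).
Proof. by move=> i j; exact: measurable_cst. Qed.

Lemma mxmeasurableB p q (F G : T -> 'M[R]_(p, q)) :
  mxmeasurable F -> mxmeasurable G -> mxmeasurable (fun x => F x - G x).
Proof.
by move=> mF mG i j; under eq_fun do rewrite !mxE; exact: measurable_funB.
Qed.

Lemma mxmeasurableZ p q (a : T -> R) (F : T -> 'M[R]_(p, q)) :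
  measurable_fun [set: T] a -> mxmeasurable F -> mxmeasurable (fun x => a x *: F x).
Proof.
by move=> ma mF i j; under eq_fun do rewrite !mxE; exact: measurable_funM.
Qed.

Lemma mxmeasurable_sum p q (I : Type) (s : seq I) (A : pred I) (F : I -> T -> 'M[R]_(p, q)) :
  (forall i, mxmeasurable (F i)) -> mxmeasurable (fun x => \sum_(i <- s | A i) F i x).
Proof.
move=> mF i j; under eq_fun do rewrite summxE -big_filter.
by apply: measurable_sum => k; exact: mF.
Qed.

Lemma measurable_det p (F : T -> 'M[R]_p) :
  mxmeasurable F -> measurable_fun [set: T] (fun x => \det (F x)).
Proof.
move=> mF; apply: measurable_sum => s; apply: measurable_funM => //.
by apply: measurable_prod => i _; exact: mF.
Qed.

Lemma mxmeasurable_inv_or p (W F : T -> 'M[R]_p) :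
  mxmeasurable W -> mxmeasurable F -> mxmeasurable (fun x => inv_or (W x) (F x)).
Proof.
move=> mW mF i j.
(* Cramer's rule: on the nonsingular event an entry of the inverse is a cofactor, with transposed
   indices, over the determinant. *)
rewrite (_ : (fun x => _) = fun x => if \det (F x) == 0 then W x i j
    else (\det (F x))^-1 * ((-1) ^+ (j + i) * \det (row' j (col' i (F x))))).
  apply: measurable_fun_ifT; [|exact: mW|].
    by apply: measurable_fun_eqr => //; exact: measurable_det.
  apply: measurable_funM; first by apply: measurable_fun_inv; exact: measurable_det.
  apply: measurable_funM => //; apply: measurable_det => k l.
  by under eq_fun do rewrite !mxE; exact: mF.
apply/funext => x; rewrite /inv_or unitmxE unitfE.
case: eqP => //= /eqP Fx0; rewrite /invmx unitmxE unitfE Fx0 !mxE.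
done.
Qed.

End measurable_matrices.

(** * The supremum as a maximum over a grid, and measurability of the rejection event *)

Section test_statistic.
Context {R : realType} {d : nat} {dX : measure_display} {X : measurableType dX}.
Variables (P : 'cV[R]_d -> probability X R) (psi : X -> 'cV[R]_d).

(** [Zn] depends on [u] only through the integer part of [u n], so the points [j / n] with [j] from
    0 to [n] exhaust the values under the supremum. *)
Lemma Tn_gtP (n : nat) (W : 'M[R]_d) (x : 'I_n -> X) (theta : 'cV[R]_d) (c : R) :
  (0 < n)%N ->
  let q u := `| ((Zn P psi x u theta)^T *m inv_or W (Sigma_hat P psi x theta)
                   *m Zn P psi x u theta) 0 0 | in
  c < Tn P psi W x theta <-> exists j : 'I_n.+1, c < n%:R * q (j%:R / n%:R).
Proof.
move=> n_gt0 q; have n0 : 0 < n%:R :> R by rewrite ltr0n.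
have qE u : 0 <= u <= 1 -> exists j : 'I_n.+1, q u = q (j%:R / n%:R).
  move=> /andP[u0 u1]; have un0 : 0 <= u * n%:R by rewrite mulr_ge0.
  have jn : (Num.truncn (u * n%:R) < n.+1)%N.
    rewrite ltnS truncn_le_nat (le_lt_trans (_ : _ <= n%:R)) ?ltr_nat//.
    by rewrite ler_piMl// ltW.
  exists (Ordinal jn); rewrite /q /Zn /= mulfVK ?gt_eqF// natrK.
  by [].
set S := [set q u | u in `[0, 1]%classic].
have S0 : S !=set0.
  by exists (q 0), 0 => //=; rewrite in_itv/= lexx ler01.
have Sub : has_ubound S.
  (* The sum of the finitely many nonnegative values bounds each of them. *)
  exists (\sum_(j < n.+1) q (j%:R / n%:R)) => _ [u /= + <-]; rewrite in_itv/=.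
  move=> /qE[j ->]; rewrite (bigD1 j)//= lerDl; apply: sumr_ge0 => i _; exact: normr_ge0.
rewrite /Tn -/S; split=> [|[j cj]].
  rewrite -ltr_pdivrMl// => /(sup_gt S0)[_ [u + <-]].
  rewrite /= in_itv/= => /qE[j ->]; rewrite ltr_pdivrMl// => cj.
  by exists j.
apply: lt_le_trans cj _; rewrite ler_pM2l//; apply: ub_le_sup => //.
exists (j%:R / n%:R) => //=; rewrite in_itv/= divr_ge0//= ler_pdivrMr// mul1r.
by rewrite ler_nat -ltnS.
Qed.

Lemma measurable_Tn_gt {dO : measure_display} {Omega : measurableType dO}
    (n : nat) (W : Omega -> 'M[R]_d) (x : 'I_n -> Omega -> X)
    (theta : Omega -> 'cV[R]_d) (c : R) :
  0 < c -> mxmeasurable W -> (forall k, mxmeasurable (fun w => psi (x k w))) ->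
  mxmeasurable (fun w => mean_vec P psi (theta w)) ->
  measurable [set w | c < Tn P psi (W w) (fun k => x k w) (theta w)].
Proof.
move=> c_gt0 mW mx mtheta; have [n0|n_gt0] := posnP n.
  (* For an empty sample the factor [n%:R] makes the statistic 0, which does not exceed [c]. *)
  rewrite (_ : [set _ | _] = set0)//; apply/seteqP; split=> // w /=.
  by rewrite /Tn [in n%:R]n0 mul0r ltNge ltW.
pose q u w := `| ((Zn P psi (x ^~ w) u (theta w))^T
    *m inv_or (W w) (Sigma_hat P psi (x ^~ w) (theta w))
    *m Zn P psi (x ^~ w) u (theta w)) 0 0 |.
rewrite (_ : [set _ | _] =
    \bigcup_(j in [set: 'I_n.+1]) [set w | c < n%:R * q (j%:R / n%:R) w]).
  apply: fin_bigcup_measurable => [|j _]; first exact: finite_finset.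
  rewrite -[X in measurable X]setTI.
  suff mq : measurable_fun [set: Omega] (q (j%:R / n%:R)).
    have := @measurable_fun_ltr _ _ R setT _ _ (@measurable_cst _ _ Omega R setT c)
      (measurable_funM (@measurable_cst _ _ Omega R setT n%:R) mq).
    by move=> /(_ measurableT [set true]); rewrite setTI; exact.
  apply: measurableT_comp => //.
  have mdev k : mxmeasurable (fun w => psi (x k w) - mean_vec P psi (theta w)).
    exact: mxmeasurableB.
  have mZ : mxmeasurable (fun w => Zn P psi (x ^~ w) (j%:R / n%:R) (theta w)).
    by apply: mxmeasurableZ => //; apply: mxmeasurable_sum.
  apply: mxmeasurableM => //; apply: mxmeasurableM; first exact: mxmeasurable_tr.
  apply: mxmeasurable_inv_or => //; apply: mxmeasurableZ => //.
  apply: mxmeasurable_sum => k; apply: mxmeasurableM => //.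
  exact: mxmeasurable_tr.
apply/seteqP; split=> w /=; first by move=> /(Tn_gtP _ _ _ _ n_gt0)[j]; exists j.
by move=> [j _ cj]; apply/(Tn_gtP _ _ _ _ n_gt0); exists j.
Qed.

End test_statistic.

(** * Two-sample laws of large numbers *)

Section law_transfer.
Context {R : realType} {dO dT : measure_display}.
Context {Omega : measurableType dO} {T : measurableType dT}.
Context {Pr : probability Omega R} (Y : {RV Pr >-> T}) (Q : probability T R).
Hypothesis YQ : forall A, measurable A -> distribution Pr Y A = Q A.
Local Open Scope ereal_scope.

(** This version for nonnegative functions applies before integrability is known: it carries the
    second moments from [Q] to the sample. *)
Lemma ge0_expectation_law (g : T -> R) : measurable_fun [set: T] g ->
  (forall x, 0 <= g x)%R -> 'E_Pr[g \o Y] = 'E_Q[g].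
Proof.
move=> mg g0; rewrite unlock [RHS](eq_measure_integral (distribution Pr Y)) => [|A mA _].
  rewrite ge0_integral_distribution//; first exact/measurable_EFinP.
by apply/esym; exact: YQ.
Qed.

Lemma expectation_law (g : T -> R) : measurable_fun [set: T] g ->
  g \o Y \in Lfun Pr 1 -> 'E_Pr[g \o Y] = 'E_Q[g].
Proof.
move=> mg /Lfun1_integrable gY.
rewrite unlock [RHS](eq_measure_integral (distribution Pr Y)) => [|A mA _].
  by rewrite integral_distribution//; exact/measurable_EFinP.
by apply/esym; exact: YQ.
Qed.

End law_transfer.

Lemma sum_ltn_split (V : zmodType) (n m : nat) (f : bool -> V) : (m <= n)%N ->
  \sum_(k < n) f (k < m)%N = f true *+ m + f false *+ (n - m).
Proof.
move=> mn; rewrite -(big_mkord xpredT (fun k => f (k < m)%N)) (big_cat_nat _ mn)//=.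
rewrite (eq_big_nat _ _ (F2 := fun=> f true)) => [|k /andP[_ ->]//].
rewrite [X in _ + X](eq_big_nat _ _ (F2 := fun=> f false)) => [|k /andP[mk _]].
  by rewrite !sumr_const_nat subn0.
by rewrite ltnNge mk.
Qed.

Lemma det_continuous (R : numFieldType) (p : nat) :
  continuous (fun A : 'M[R]_p => \det A).
Proof.
move=> A; rewrite /determinant.
have FA : Filter (nbhs A) by exact: nbhs_filter.
have addC : continuous (fun x : R * R => x.1 + x.2) by move=> x; exact: add_continuous.
have mulC : continuous (fun x : R * R => x.1 * x.2) by move=> x; exact: mul_continuous.
apply: (cvg_big addC FA).
move=> s _; apply: cvgM; first exact: cvg_cst.
apply: (cvg_big mulC FA).
by move=> i _; exact: coord_continuous.
Qed.

(** Nonvanishing of the continuous determinant is an open condition, and balls of matrices are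
    described entrywise. *)
Lemma det_neq0_near (R : realFieldType) (p : nat) (G : 'M[R]_p) : \det G != 0 ->
  exists2 e : R, 0 < e & forall A : 'M[R]_p, (forall i j, `|A i j - G i j| < e) -> \det A != 0.
Proof.
move=> G0; have : \forall A \near G, \det A != 0.
  apply: (@det_continuous R p G [set x | x != 0]).
  by apply: open_nbhs_nbhs; split => //; exact: open_neq.
move=> /nbhs_ballP[e/= e0 H]; exists e => // A AG; apply: H; split => // i j.
by rewrite /ball/= distrC.
Qed.

Lemma measurable_set_ltr {R : realType} {d : measure_display} {T : measurableType d}
    (f g : T -> R) : measurable_fun [set: T] f -> measurable_fun [set: T] g ->
  measurable [set x | f x < g x].
Proof.
move=> mf mg; have := measurable_fun_ltr mf mg.
by move=> /(_ measurableT [set true]); rewrite setTI; exact.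
Qed.

Lemma cvg_invn (R : realType) : (n%:R^-1 : R) @[n --> \oo] --> (0 : R).
Proof.
apply/(gtr0_cvgV0 (f := fun n => n%:R)); last exact: cvgr_idn.
by exists 1%N => // n /=; rewrite ltr0n.
Qed.

Section two_samples.
Context {R : realType} {dO dX : measure_display}.
Context {Omega : measurableType dO} {X : measurableType dX}.
Variables (Pr : probability Omega R) (Q : bool -> probability X R).
Variables (m : nat -> nat) (u : R) (Xn : forall n, 'I_n -> {RV Pr >-> X}).
Hypothesis Xn_indep : forall n, mutually_independent (@Xn n).
Hypothesis Xn_law : forall n (k : 'I_n) A, measurable A ->
  distribution Pr (Xn k) A = Q (k < m n)%N A.
Hypothesis m_le : forall n, (m n <= n)%N.
Hypothesis m_cvg : (m n)%:R / n%:R @[n --> \oo] --> u.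

Let r n : R := (m n)%:R / n%:R.

Lemma sample_mean n (f : bool -> R) : (0 < n)%N ->
  n%:R^-1 * \sum_(k < n) f (k < m n)%N = r n * f true + (1 - r n) * f false.
Proof.
move=> n0; rewrite sum_ltn_split// -[_ *+ m n]mulr_natr -[_ *+ (n - m n)]mulr_natr natrB// /r.
by field; rewrite pnatr_eq0 -lt0n.
Qed.

Section square_integrable.
Variable g : X -> R.
Hypothesis mg : measurable_fun [set: X] g.
Hypothesis g2 : forall b, ('E_(Q b)[fun x => (g x ^+ 2)%R] < +oo)%E.

Let C b := fine ('E_(Q b)[fun x => (g x ^+ 2)%R])%E.

Let CE b : ('E_(Q b)[fun x => (g x ^+ 2)%R] = (C b)%:E)%E.
Proof.
rewrite /C fineK// ge0_fin_numE// expectation_ge0// => x; exact: sqr_ge0.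
Qed.

Let C_ge0 b : 0 <= C b.
Proof. by apply: fine_ge0; apply: expectation_ge0 => x; exact: sqr_ge0. Qed.

Let expectation_sqr_sample n (k : 'I_n) :
  'E_Pr[fun w => (g (Xn k w) ^+ 2)%R]%E = (C (k < m n)%N)%:E.
Proof.
rewrite -CE -(ge0_expectation_law (@Xn_law n k))//; last by move=> x; exact: sqr_ge0.
exact: measurable_funX.
Qed.

Let sample_Lfun2 n (k : 'I_n) : g \o Xn k \in Lfun Pr 2%:E.
Proof.
apply: Lfun2_sqr_lty; first exact: measurableT_comp.
by rewrite expectation_sqr_sample ltry.
Qed.

(** Bounded weights that vary with [n] and with the side of the change point cover both plain
    averages and recentred partial sums. The mean comes within [eps / 2] of [l], and Chebyshev's
    inequality controls the remaining [eps / 2] at rate [1 / n]. *)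
Lemma two_sample_lln (a : nat -> bool -> R) (l eps : R) :
  (forall n b, `|a n b| <= 1) ->
  r n * (a n true * fine 'E_(Q true)[g]%E)
    + (1 - r n) * (a n false * fine 'E_(Q false)[g]%E) @[n --> \oo] --> l ->
  0 < eps ->
  whp Pr (fun n => [set w |
    `| n%:R^-1 * \sum_(k < n) a n (k < m n)%N * g (Xn k w) - l | < eps]).
Proof.
move=> a1 al eps0; have eps20 : 0 < eps / 2 by rewrite divr_gt0.
pose D := C true + C false.
have CD b : C b <= D by case: b; rewrite /D ?lerDl ?lerDr.
have D0 : 0 <= D by rewrite addr_ge0.
have mg_X n (k : 'I_n) : measurable_fun [set: Omega] (fun w => g (Xn k w)).
  exact: measurableT_comp.
apply: (@whp_ub _ _ _ _ _ (fun n => (eps / 2) ^- 2 * (D * n%:R^-1))).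
- move=> n; apply: measurable_set_ltr => //; apply: measurableT_comp => //.
  apply: measurable_funB => //; apply: measurable_funM => //.
  by apply: measurable_sum => k; exact: measurable_funM.
- near=> n.
  have n0 : (0 < n)%N by near: n; exact: nbhs_infty_gt.
  have nR : 0 < n%:R :> R by rewrite ltr0n.
  (* The factor [1 / n] is absorbed into the weights, whose squares then sum to at most [1 / n]. *)
  pose b (k : 'I_n) := n%:R^-1 * a n (k < m n)%N.
  have b2 : \sum_k b k ^+ 2 <= n%:R^-1.
    apply: (@le_trans _ _ (\sum_(k < n) n%:R^-1 ^+ 2)).
      apply: ler_sum => k _; rewrite exprMn ler_piMr ?sqr_ge0//.
      by rewrite -real_normK ?num_real// expr_le1.
    rewrite sumr_const card_ord -(mulr_natr (_ ^+ 2)) expr2 -mulrA mulVf ?mulr1//.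
    by rewrite gt_eqF.
  have meanE : \sum_k b k * fine 'E_Pr[g \o @Xn n k]%E =
      r n * (a n true * fine 'E_(Q true)[g]%E)
      + (1 - r n) * (a n false * fine 'E_(Q false)[g]%E).
    rewrite -(sample_mean (fun b => a n b * fine 'E_(Q b)[g]%E))// mulr_sumr.
    apply: eq_bigr => k _; rewrite /b -mulrA; congr (_ * (_ * fine _)).
    by apply: (expectation_law (@Xn_law n k)) => //; exact: Lfun2_Lfun1.
  have meanl : `| \sum_k b k * fine 'E_Pr[g \o @Xn n k]%E - l | < eps / 2.
    by rewrite meanE distrC; near: n; move/cvgrPdist_lt : al; exact.
  have EC (k : 'I_n) : ('E_Pr[fun w => (g (Xn k w) ^+ 2)%R] <= D%:E)%E.
    by rewrite expectation_sqr_sample lee_fin.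
  have := chebyshev_indep b (@Xn_indep n) mg EC eps20.
  have sumE w : n%:R^-1 * \sum_(k < n) a n (k < m n)%N * g (Xn k w)
      = \sum_k b k * g (Xn k w).
    by rewrite mulr_sumr; apply: eq_bigr => k _; rewrite /b mulrA.
  move=> cheb; apply: (@le_trans _ _ ((eps / 2) ^- 2 * (D * \sum_k b k ^+ 2))%:E).
    apply: le_trans cheb; apply: le_measure; rewrite ?inE.
    - apply: measurableC; apply: measurable_set_ltr => //.
      apply: measurableT_comp => //; apply: measurable_funB => //.
      apply: measurable_funM => //.
      by apply: measurable_sum => k; exact: measurable_funM.
    - rewrite -[X in measurable X]setCK; apply: measurableC.
      rewrite [X in measurable X](_ : _ = [set w | `|\sum_k b k * g (Xn k w) -
          \sum_k b k * fine 'E_Pr[g \o @Xn n k]%E| < eps / 2]).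
        apply: measurable_set_ltr => //.
        apply: measurableT_comp => //; apply: measurable_funB => //.
        by apply: measurable_sum => k; exact: measurable_funM.
      by apply/seteqP; split=> w /=; rewrite ltNge => /negP.
    - move=> w /= /negP; rewrite -leNgt sumE => epsw.
      set s := \sum_k _ in epsw *; set t := \sum_k _ in meanl *.
      have : eps <= `|s - t| + `|t - l| by apply: le_trans epsw (ler_distD _ _ _).
      lra.
  by rewrite lee_fin ler_wpM2l ?invr_ge0 ?sqr_ge0// ler_wpM2l.
- rewrite -[X in _ --> X](mulr0 ((eps / 2) ^- 2)); apply: cvgMr.
  rewrite -[X in _ --> X](mulr0 D); apply: cvgMr.
  exact: cvg_invn.
Unshelve. all: by end_near. Qed.

(** Only the mean of [g ^+ 2] is known to be finite, which rules out Chebyshev's inequality for it;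
    Markov's inequality suffices because the threshold grows like [n]. *)
Lemma two_sample_sqr_tight (delta : R) : 0 < delta ->
  whp Pr (fun n => [set w |
    n%:R^-1 * \sum_(k < n) g (Xn k w) ^+ 2 < n%:R * delta]).
Proof.
move=> delta0; pose D := C true + C false.
have CD b : C b <= D by case: b; rewrite /D ?lerDl ?lerDr.
have mg_X n (k : 'I_n) : measurable_fun [set: Omega] (fun w => g (Xn k w) ^+ 2).
  by apply: measurable_funX; exact: measurableT_comp.
have mS n : measurable_fun [set: Omega] (fun w => \sum_(k < n) g (Xn k w) ^+ 2).
  by apply: measurable_sum => k; exact: mg_X.
have ES n : ('E_Pr[fun w => (\sum_(k < n) g (Xn k w) ^+ 2)%R] <= (n%:R * D)%:E)%E.
  pose Y (k : 'I_n) : Omega -> R := fun w => g (Xn k w) ^+ 2.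
  have -> : (fun w => \sum_(k < n) g (Xn k w) ^+ 2) = \sum_k Y k.
    by apply/funext => w; rewrite fct_sumE.
  have Y1 (k : 'I_n) : Y k \in Lfun Pr 1.
    exact: (Lfun2_mul_Lfun1 (sample_Lfun2 k) (sample_Lfun2 k)).
  rewrite -[leLHS]fineK; last by apply: expectation_fin_num; exact: rpred_sum.
  rewrite fine_expectation_sum// lee_fin.
  apply: (@le_trans _ _ (\sum_(k < n) D)).
    by apply: ler_sum => k _; rewrite /Y expectation_sqr_sample; exact: CD.
  by rewrite sumr_const card_ord -(mulr_natl D).
apply: (@whp_ub _ _ _ _ _ (fun n => delta^-1 * (D * n%:R^-1))).
- move=> n; apply: measurable_set_ltr => //.
  exact: measurable_funM.
- near=> n.
  have n0 : (0 < n)%N by near: n; exact: nbhs_infty_gt.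
  have nR : 0 < n%:R :> R by rewrite ltr0n.
  (* Markov's inequality is applied to the unnormalised sum, of mean at most [n D], at level
     [n (n delta)]; this leaves [D / (n delta)]. *)
  have e0 : 0 < n%:R * (n%:R * delta) by rewrite !mulr_gt0.
  pose S := HB.pack_for {mfun Omega >-> R} (fun w => \sum_(k < n) g (Xn k w) ^+ 2)
    (isMeasurableFun.Build _ _ _ _ _ (mS n)).
  have S_ge0 w : 0 <= S w by apply: sumr_ge0 => k _; exact: sqr_ge0.
  have := @markov _ _ _ Pr S id _ e0 (@measurable_id _ _ _) (fun _ => id)
    (fun _ _ _ _ => id).
  rewrite (_ : [set x | _] = ~` [set w | n%:R^-1 * \sum_(k < n) g (Xn k w) ^+ 2
                                         < n%:R * delta]); last first.
    apply/seteqP; split=> w /=; rewrite lee_fin (ger0_norm (S_ge0 w)).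
      by rewrite ltr_pdivrMl// leNgt => /negP.
    by move/negP; rewrite -leNgt ler_pdivlMl.
  rewrite (_ : id \o _ \o S = S); last first.
    by apply/funext => w /=; rewrite (ger0_norm (S_ge0 w)).
  move=> /le_trans -/(_ _ (ES n)); rewrite -lee_pdivlMl// -EFinM => /le_trans; apply.
  rewrite lee_fin le_eqVlt; apply/orP; left; apply/eqP; field.
  by rewrite !gt_eqF.
- rewrite -[X in _ --> X](mulr0 delta^-1); apply: cvgMr.
  rewrite -[X in _ --> X](mulr0 D); apply: cvgMr.
  exact: cvg_invn.
Unshelve. all: by end_near. Qed.

End square_integrable.
End two_samples.

(** * Nonsingularity in the limit *)

Lemma expectation_ae0 {R : realType} {d : measure_display} {T : measurableType d}
    (P : probability T R) (F : T -> R) : measurable_fun [set: T] F ->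
  {ae P, forall x, F x = 0} -> 'E_P[F]%E = 0%E.
Proof.
move=> mF F0; rewrite unlock (@ae_eq_integral _ _ _ P setT (cst 0%E))//.
- by rewrite integral0.
- exact/measurable_EFinP.
- by apply: filterS F0 => x /= -> _.
Qed.

Lemma expectation_sqr0_ae {R : realType} {d : measure_display} {T : measurableType d}
    (P : probability T R) (F : T -> R) : measurable_fun [set: T] F ->
  ('E_P[fun x => (F x ^+ 2)%R] = 0)%E -> {ae P, forall x, F x = 0}.
Proof.
move=> mF; rewrite unlock => F0.
have mF2 : measurable_fun [set: T] (fun x => (F x ^+ 2)%:E).
  by apply/measurable_EFinP; exact: measurable_funX.
have /(ae_eq_integral_abs P measurableT mF2) : (\int[P]_x `|(F x ^+ 2)%:E| = 0)%E.
  by rewrite -[RHS]F0; apply: eq_integral => x _; rewrite gee0_abs// lee_fin sqr_ge0.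
apply: filterS => x /= /(_ I) [] /eqP; rewrite sqrf_eq0.
by move/eqP.
Qed.

Lemma Lfun_bounded {R : realType} {d : measure_display} {T : measurableType d}
    (P : probability T R) (F : T -> R) (M : R) : measurable_fun [set: T] F ->
  (forall x, `|F x| <= M) -> F \in Lfun P 2%:E.
Proof.
move=> mF FM; apply: Lfun2_sqr_lty => //.
apply: (@le_lt_trans _ _ (M ^+ 2)%:E); last exact: ltry.
rewrite -(expectation_cst P (M ^+ 2)); apply: expectation_le => //.
- exact: measurable_funX.
- by move=> x; exact: sqr_ge0.
- by move=> x; exact: sqr_ge0.
apply/aeW => x; rewrite -real_normK ?num_real//.
by rewrite lerXn2r ?nnegrE// (le_trans _ (FM x)).
Qed.

Section second_moment_matrix.
Context {R : realType} {d : measure_display} {T : measurableType d}.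
Variable P : probability T R.

Definition moment_mx p (phi : T -> 'cV[R]_p) : 'M[R]_p :=
  \matrix_(i, j) fine 'E_P[fun x => (phi x i 0 * phi x j 0)%R]%E.

Lemma moment_mx_form p (phi : T -> 'cV[R]_p) (v : 'rV[R]_p) :
  (forall i, (fun x => phi x i 0) \in Lfun P 2%:E) ->
  ((v *m moment_mx phi *m v^T) 0 0)%:E = 'E_P[fun x => ((v *m phi x) 0 0 ^+ 2)%R]%E.
Proof.
move=> phi2.
pose Y (k : 'I_p * 'I_p) := (v 0 k.1 * v 0 k.2) \o* (fun x => phi x k.1 0 * phi x k.2 0).
have phi1 (k : 'I_p * 'I_p) : (fun x => phi x k.1 0 * phi x k.2 0) \in Lfun P 1.
  exact: (Lfun2_mul_Lfun1 (phi2 k.1) (phi2 k.2)).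
have Y1 k : Y k \in Lfun P 1 by exact: Lfun_scale.
have -> : (fun x => (v *m phi x) 0 0 ^+ 2) = \sum_k Y k.
  apply/funext => x; rewrite fct_sumE mxE expr2 big_distrlr/= pair_big/=.
  by apply: eq_bigr => k _; rewrite /Y/=; ring.
rewrite -[RHS]fineK; last by apply: expectation_fin_num; exact: rpred_sum.
rewrite fine_expectation_sum// mxE; congr (_%:E).
under eq_bigr => j _ do rewrite mxE mulr_suml.
rewrite exchange_big pair_big/=; apply: eq_bigr => k _.
rewrite /Y expectationZl// fineM ?expectation_fin_num// !mxE/=; ring.
Qed.

Lemma moment_mx_form_ge0 p (phi : T -> 'cV[R]_p) (v : 'rV[R]_p) :
  (forall i, (fun x => phi x i 0) \in Lfun P 2%:E) ->
  0 <= (v *m moment_mx phi *m v^T) 0 0.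
Proof.
move=> phi2; rewrite -lee_fin moment_mx_form//; apply: expectation_ge0 => x.
exact: sqr_ge0.
Qed.

End second_moment_matrix.

Section covariance_kernel.
Context {R : realType} {d : nat} {dX : measure_display} {X : measurableType dX}.
Variables (P : 'cV[R]_d -> probability X R) (psi : X -> 'cV[R]_d) (theta : 'cV[R]_d).
Hypothesis psi2 : forall i, (fun x => psi x i 0) \in Lfun (P theta) 2%:E.

(** Integrating the affine relation gives [y m = - c], so [y (psi - m)] vanishes almost surely;
    entry [j] of the product is the mean of this variable times [(psi - m) j]. *)
Lemma cov_mx_ker (y : 'rV[R]_d) (c : R) :
  {ae P theta, forall x, c + (y *m psi x) 0 0 = 0} ->
  y *m cov_mx P psi theta = 0.
Proof.
move=> y0; set m := mean_vec P psi theta.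
have psi1 i : (fun x => psi x i 0) \in Lfun (P theta) 1 by exact: Lfun2_Lfun1.
have mpsi i : measurable_fun [set: X] (fun x => psi x i 0).
  by have := psi2 i; rewrite inE => /andP[+ _]; rewrite inE.
have myx (a : 'cV[R]_d) : measurable_fun [set: X] (fun x => (y *m (psi x - a)) 0 0).
  under eq_fun do rewrite mxE.
  apply: measurable_sum => i; apply: measurable_funM => //.
  by under eq_fun do rewrite !mxE; exact: measurable_funB.
have ym : (y *m m) 0 0 = - c.
  have -> : (y *m m) 0 0 = fine 'E_(P theta)[(\sum_i y 0 i \o* (fun x => psi x i 0))%R]%E.
    rewrite fine_expectation_sum => [|i]; last exact: Lfun_scale.
    rewrite mxE; apply: eq_bigr => i _.
    by rewrite expectationZl// fineM ?expectation_fin_num// mxE.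
  have mS : measurable_fun [set: X] (fun x => (y *m psi x) 0 0).
    by have := myx 0; under eq_fun do rewrite subr0.
  have -> : \sum_i y 0 i \o* (fun x => psi x i 0) = (fun x => (y *m psi x) 0 0).
    by apply/funext => x; rewrite fct_sumE mxE; apply: eq_bigr => i _; rewrite mulrC.
  rewrite -[RHS]/(fine (- c)%:E) -(expectation_cst (P theta) (- c)); congr fine.
  rewrite unlock; apply: ae_eq_integral => //; try exact/measurable_EFinP.
  apply: filterS y0 => x /= cy _; congr EFin; apply/eqP.
  by rewrite -addr_eq0 addrC cy.
have y0' : {ae P theta, forall x, (y *m (psi x - m)) 0 0 = 0}.
  apply: filterS y0 => x cy.
  by rewrite mulmxBr [LHS]mxE [X in _ + X]mxE ym opprK addrC.
apply/matrixP => k j; rewrite ord1 [RHS]mxE mxE.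
have dev2 i : (fun x => psi x i 0 - m i 0) \in Lfun (P theta) 2%:E.
  by apply: rpredB; rewrite ?lee1n//= => _; exact: Lfun_cst.
pose Y i := y 0 i \o* (fun x => (psi x i 0 - m i 0) * (psi x j 0 - m j 0)).
have dev1 i : (fun x => (psi x i 0 - m i 0) * (psi x j 0 - m j 0)) \in Lfun (P theta) 1.
  exact: (Lfun2_mul_Lfun1 (dev2 i) (dev2 j)).
have Y1 i : Y i \in Lfun (P theta) 1 by exact: Lfun_scale.
transitivity (fine 'E_(P theta)[(\sum_i Y i)%R]%E).
  rewrite fine_expectation_sum//; apply: eq_bigr => i _.
  rewrite expectationZl// fineM ?expectation_fin_num//= !mxE; congr (_ * fine _).
  by congr expectation; apply/funext => x; rewrite mxE big_ord1 !mxE.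
rewrite expectation_ae0//.
  have : \sum_i Y i \in Lfun (P theta) 1 by exact: rpred_sum.
  by rewrite inE => /andP[+ _]; rewrite inE.
apply: filterS y0' => x yx; rewrite fct_sumE.
transitivity ((y *m (psi x - m)) 0 0 * (psi x j 0 - m j 0)); last by rewrite yx mul0r.
rewrite [X in _ = X * _]mxE mulr_suml.
apply: eq_bigr => i _; rewrite /Y/= [(psi x - m) i 0]mxE [(- m) i 0]mxE; ring.
Qed.

End covariance_kernel.

Section projective_lift.
Context {R : realType} {d : nat}.

(* A positive multiple of [(1, x)]; the normalisation bounds its entries by [1],
   so that their products have finite second moments whatever the law of [x]. *)
Definition scaled_lift (x : 'cV[R]_d) : 'cV[R]_(1 + d) :=
  (1 + \sum_i `|x i 0|)^-1 *: col_mx 1%:M x.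

Lemma scaled_lift_den_gt0 (x : 'cV[R]_d) : 0 < 1 + \sum_i `|x i 0|.
Proof. by rewrite ltr_pwDl// sumr_ge0. Qed.

Lemma scaled_lift_le1 (x : 'cV[R]_d) i : `|scaled_lift x i 0| <= 1.
Proof.
have den0 := scaled_lift_den_gt0 x.
rewrite /scaled_lift mxE normrM normfV (gtr0_norm den0) mulrC ler_pdivrMr// mul1r.
case: (split_ordP i) => j ->.
  by rewrite col_mxEu ord1 mxE eqxx normr1 lerDl sumr_ge0.
rewrite col_mxEd (bigD1 j)//= addrCA lerDl addr_ge0// sumr_ge0//.
Qed.

Lemma mxmeasurable_scaled_lift {dX : measure_display} {X : measurableType dX}
    (psi : X -> 'cV[R]_d) :
  mxmeasurable psi -> mxmeasurable (fun x => scaled_lift (psi x)).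
Proof.
move=> mpsi; apply: mxmeasurableZ.
  apply: measurable_fun_inv; apply: measurable_funD => //.
  by apply: measurable_sum => i; apply: measurableT_comp => //; exact: mpsi.
move=> i j; case: (split_ordP i) => k ->.
  by under eq_fun do rewrite col_mxEu; exact: measurable_cst.
by under eq_fun do rewrite col_mxEd; exact: mpsi.
Qed.

(** The form is the mean of the square of [v *m scaled_lift (psi x)], so this pairing is almost
    surely 0, and the positive normalising factor cancels. *)
Lemma moment_scaled_lift_ker {dX : measure_display} {X : measurableType dX}
    (Q : probability X R) (psi : X -> 'cV[R]_d) (v : 'rV[R]_(1 + d)) :
  mxmeasurable psi ->
  (v *m moment_mx Q (fun x => scaled_lift (psi x)) *m v^T) 0 0 = 0 ->
  {ae Q, forall x, lsubmx v 0 0 + (rsubmx v *m psi x) 0 0 = 0}.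
Proof.
move=> mpsi v0; have mlift := mxmeasurable_scaled_lift mpsi.
have lift2 i : (fun x => scaled_lift (psi x) i 0) \in Lfun Q 2%:E.
  by apply: (@Lfun_bounded _ _ _ _ _ 1) => // x; exact: scaled_lift_le1.
have mv : measurable_fun [set: X] (fun x => (v *m scaled_lift (psi x)) 0 0).
  by apply: mxmeasurableM => //; exact: mxmeasurable_cst.
have := moment_mx_form v lift2; rewrite v0 => /esym/(expectation_sqr0_ae mv).
apply: filterS => x /eqP; rewrite /scaled_lift -scalemxAr mxE mulf_eq0 invr_eq0.
rewrite gt_eqF ?scaled_lift_den_gt0//= -{1}[v]hsubmxK mul_row_col mulmx1 mxE.
by move/eqP.
Qed.

End projective_lift.

Section nonsingular_limit.
Context {R : realType} {d : nat} {dX : measure_display} {X : measurableType dX}.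
Variables (P : 'cV[R]_d -> probability X R) (psi : X -> 'cV[R]_d).
Variables (theta0 theta1 : 'cV[R]_d) (u : R).
Hypothesis u01 : 0 < u < 1.
Hypothesis mpsi : mxmeasurable psi.
Hypothesis psi2_0 : forall i, (fun x => psi x i 0) \in Lfun (P theta0) 2%:E.
Hypothesis psi2_1 : forall i, (fun x => psi x i 0) \in Lfun (P theta1) 2%:E.

Lemma moment_mix_det_neq0 :
  u *: cov_mx P psi theta0 + (1 - u) *: cov_mx P psi theta1 \in unitmx ->
  \det (u *: moment_mx (P theta0) (fun x => scaled_lift (psi x))
    + (1 - u) *: moment_mx (P theta1) (fun x => scaled_lift (psi x))) != 0.
Proof.
have /andP[u0 u1] := u01; have u1' : 0 < 1 - u by rewrite subr_gt0.
move=> Sunit; apply/negP => /det0P[v v0 vG].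
set M0 := moment_mx (P theta0) _ in vG; set M1 := moment_mx (P theta1) _ in vG.
have mlift := mxmeasurable_scaled_lift mpsi.
have lift2 (theta : 'cV[R]_d) i :
    (fun x => scaled_lift (psi x) i 0) \in Lfun (P theta) 2%:E.
  by apply: (@Lfun_bounded _ _ _ _ _ 1) => // x; exact: scaled_lift_le1.
have q0 : 0 <= (v *m M0 *m v^T) 0 0 by exact: moment_mx_form_ge0.
have q1 : 0 <= (v *m M1 *m v^T) 0 0 by exact: moment_mx_form_ge0.
(* Both forms are nonnegative and both weights positive, so each form vanishes at the same [v]. *)
have : u * (v *m M0 *m v^T) 0 0 + (1 - u) * (v *m M1 *m v^T) 0 0 = 0.
  transitivity ((v *m (u *: M0 + (1 - u) *: M1) *m v^T) 0 0).
    by rewrite mulmxDr mulmxDl -!scalemxAr -!scalemxAl [RHS]mxE; congr (_ + _);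
      rewrite [RHS]mxE.
  by rewrite vG mul0mx mxE.
have p0 := mulr_ge0 (ltW u0) q0; have p1 := mulr_ge0 (ltW u1') q1.
move=> /eqP; rewrite paddr_eq0// !mulf_eq0 (gt_eqF u0) (gt_eqF u1')/=.
move=> /andP[/eqP/(moment_scaled_lift_ker mpsi) ker0 /eqP/(moment_scaled_lift_ker mpsi) ker1].
(* The linear part annihilates both covariance matrices, hence their invertible mixture. *)
have y0 : rsubmx v = 0.
  rewrite -(mulmxK Sunit (rsubmx v)) mulmxDr -!scalemxAr.
  by rewrite (cov_mx_ker psi2_0 ker0) (cov_mx_ker psi2_1 ker1) !scaler0 addr0 mul0mx.
(* With no linear part left, a nonzero constant would make the whole space a null set. *)
have c0 : lsubmx v = 0.
  apply/matrixP => i j; rewrite !ord1 [RHS]mxE; apply/eqP/negPn/negP => c0.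
  have : {ae P theta0, forall x : X, False}.
    by apply: filterS ker0 => x; rewrite y0 mul0mx [X in _ + X]mxE addr0 => /eqP; exact/negP.
  move=> [N [mN N0 subN]].
  have : P theta0 [set: X] = 0%E.
    by apply: (subset_measure0 _ mN _ N0) => // x _; apply: subN => /=.
  by rewrite probability_setT => /eqP; rewrite onee_eq0.
by move: v0; rewrite -[v]hsubmxK y0 c0 row_mx0 eqxx.
Qed.

End nonsingular_limit.

(** * Lower bound of the test statistic *)

(* Weights turning the sample into the recentred partial sum of the first [m]
   observations. *)
Definition bridge_weight (R : realType) (n m : nat) (b : bool) : R :=
  b%:R - m%:R / n%:R.

Section deterministic_bound.
Context {R : realType} {d : nat} {dX : measure_display} {X : measurableType dX}.
Variables (P : 'cV[R]_d -> probability X R) (psi : X -> 'cV[R]_d).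
Variables (n m : nat) (x : 'I_n -> X) (theta : 'cV[R]_d).
Hypotheses (n_gt0 : (0 < n)%N) (m_le : (m <= n)%N).
Hypothesis Z1 : Zn P psi x 1 theta = 0.

Let nR : n%:R != 0 :> R. Proof. by rewrite pnatr_eq0 -lt0n. Qed.

Lemma mean_vec_estimator i :
  mean_vec P psi theta i 0 = n%:R^-1 * \sum_(k < n) psi (x k) i 0.
Proof.
have : Zn P psi x 1 theta i 0 = 0 by rewrite Z1 mxE.
rewrite /Zn mxE => /eqP.
rewrite mulf_eq0 invr_eq0 (negbTE nR)/= summxE => /eqP Z0.
apply: (mulfI nR); rewrite mulVKf//; apply/eqP; rewrite eq_sym -subr_eq0; apply/eqP.
transitivity (\sum_(k < n) (psi (x k) - mean_vec P psi theta) i 0); last first.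
  (* At [u = 1] the integer part is [n], so the range condition holds for every index. *)
  by rewrite -[RHS]Z0; apply: eq_bigl => k; rewrite mul1r natrK ltn_ord.
under [RHS]eq_bigr => k _ do rewrite mxE [X in _ + X]mxE.
by rewrite sumrB sumr_const card_ord -(mulr_natl (mean_vec _ _ _ _ _)).
Qed.

(** The mean vector at the estimator is the empirical mean, so centring the first [m] terms
    subtracts [m / n] times the full sum. *)
Lemma Zn_bridge i :
  Zn P psi x (m%:R / n%:R) theta i 0
  = n%:R^-1 * \sum_(k < n) bridge_weight R n m (k < m)%N * psi (x k) i 0.
Proof.
rewrite /Zn mxE divfK// natrK summxE; congr (_ * _).
under eq_bigr => k _ do rewrite mxE [X in _ + X]mxE.
under [RHS]eq_bigr => k _ do rewrite mulrBl.
rewrite !sumrB -[in RHS]mulr_sumr; congr (_ - _).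
  by rewrite big_mkcond/=; apply: eq_bigr => k _; case: ifP; rewrite ?mul1r ?mul0r.
rewrite mean_vec_estimator.
rewrite (big_mkcond (fun k : 'I_n => (k < m)%N))/=.
rewrite (sum_ltn_split (fun b => if b then n%:R^-1 * \sum_(k < n) psi (x k) i 0 else 0))//=.
by rewrite mul0rn addr0 -[LHS]mulr_natl mulrA.
Qed.

(** The diagonal entry is an empirical variance, that is, the empirical second moment minus the
    squared empirical mean. *)
Lemma Sigma_hat_diag_le i :
  Sigma_hat P psi x theta i i <= n%:R^-1 * \sum_(k < n) psi (x k) i 0 ^+ 2.
Proof.
rewrite /Sigma_hat gramE ler_wpM2l ?invr_ge0//.
set s := \sum_(k < n) psi (x k) i 0.
set e := mean_vec P psi theta i 0.
have eE : n%:R * e = s by rewrite /e mean_vec_estimator mulVKf.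
have -> : \sum_(k < n) (psi (x k) - mean_vec P psi theta) i 0
             * (psi (x k) - mean_vec P psi theta) i 0
    = \sum_(k < n) psi (x k) i 0 ^+ 2 - n%:R * e ^+ 2.
  transitivity (\sum_(k < n) (psi (x k) i 0 ^+ 2 - 2 * e * psi (x k) i 0 + e ^+ 2)).
    apply: eq_bigr => k _.
    rewrite (_ : (psi (x k) - mean_vec P psi theta) i 0 = psi (x k) i 0 - e); last first.
      by rewrite mxE [X in _ + X]mxE.
    ring.
  rewrite big_split sumrB/= -mulr_sumr -/s -eE sumr_const card_ord.
  by rewrite -(mulr_natl (e ^+ 2)); ring.
by rewrite gerBl mulr_ge0// sqr_ge0.
Qed.

(** At the grid point [m / n], with [q] the quadratic form there, [t ^+ 2 < z_i ^+ 2 <= S_ii q <= n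
    (t ^+ 2 / c) q]; cancelling [t ^+ 2] leaves [c < n q]. *)
Lemma Tn_lower_bound (W : 'M[R]_d) (c t : R) i :
  0 < c -> 0 < t -> Sigma_hat P psi x theta \in unitmx ->
  t < `| n%:R^-1 * \sum_(k < n) bridge_weight R n m (k < m)%N * psi (x k) i 0 | ->
  n%:R^-1 * \sum_(k < n) psi (x k) i 0 ^+ 2 < n%:R * (t ^+ 2 / c) ->
  c < Tn P psi W x theta.
Proof.
move=> c0 t0 Su tY Qt; apply/Tn_gtP => //; exists (Ordinal (m_le : (m < n.+1)%N)).
rewrite /inv_or Su/=; set z := Zn _ _ _ _ _; set q := (_ *m z) 0 0.
have n0 : 0 < n%:R :> R by rewrite ltr0n.
have zq : z i 0 ^+ 2 <= Sigma_hat P psi x theta i i * q.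
  exact: (sqr_le_gram_invmx z i Su).
have tz : t ^+ 2 < z i 0 ^+ 2.
  by rewrite -[ltRHS]real_normK ?num_real// ltrXn2r ?nnegrE ?ltW// Zn_bridge.
have S0 : 0 <= Sigma_hat P psi x theta i i.
  rewrite /Sigma_hat gramE mulr_ge0// sumr_ge0// => k _.
  by rewrite -expr2 sqr_ge0.
have SQ := le_lt_trans (Sigma_hat_diag_le i) Qt.
have t20 : 0 < t ^+ 2 by rewrite exprn_gt0.
(* Since [S_ii] is nonnegative, [q <= 0] would contradict the positive lower bound on [S_ii q]. *)
have q0 : 0 < q.
  rewrite ltNge; apply/negP => q_le0; have := lt_le_trans (lt_trans t20 tz) zq.
  by rewrite ltNge mulr_ge0_le0.
rewrite gtr0_norm//.
have : t ^+ 2 < n%:R * (t ^+ 2 / c) * q.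
  apply: lt_le_trans tz (le_trans zq _); rewrite ler_pM2r//; exact: ltW.
rewrite (_ : n%:R * (t ^+ 2 / c) * q = t ^+ 2 * (n%:R * q / c)); last by ring.
by rewrite ltr_pMr// ltr_pdivlMr// mul1r.
Qed.

End deterministic_bound.

Lemma truncn_ratio_cvg (R : realType) (u : R) : 0 <= u ->
  (Num.truncn (u * n%:R))%:R / n%:R @[n --> \oo] --> u.
Proof.
move=> u0; apply: (@squeeze_cvgr _ _ _ _ (fun n => u - n%:R^-1) (cst u)).
- near=> n.
  have n0 : 0 < n%:R :> R by rewrite ltr0n; near: n; exact: nbhs_infty_gt.
  have /andP[tu ut] := truncn_itv (mulr_ge0 u0 (ltW n0)).
  rewrite ler_pdivrMr// tu andbT ler_pdivlMr// mulrBl mulVf ?gt_eqF//.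
  by rewrite lerBlDr natr1 ltW.
- rewrite -[X in _ --> X]subr0; apply: cvgB; [exact: cvg_cst|exact: cvg_invn].
- exact: cvg_cst.
Unshelve. all: by end_near. Qed.

Lemma truncn_mul_le (R : realType) (u : R) n : u <= 1 -> (Num.truncn (u * n%:R) <= n)%N.
Proof.
move=> u1; rewrite truncn_le_nat (le_lt_trans (_ : _ <= n%:R)) ?ltr_nat//.
by rewrite ler_piMl.
Qed.

(** * Empirical Gram determinant and recentred partial sum under the change-point model *)

Section random_sample.
Context {R : realType} {d : nat} {dO dX : measure_display}.
Context {Omega : measurableType dO} {X : measurableType dX}.
Variables (Pr : probability Omega R) (Q : bool -> probability X R).
Variables (m : nat -> nat) (u : R) (Xn : forall n, 'I_n -> {RV Pr >-> X}).
Hypothesis Xn_indep : forall n, mutually_independent (@Xn n).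
Hypothesis Xn_law : forall n (k : 'I_n) A, measurable A ->
  distribution Pr (@Xn n k) A = Q (k < m n)%N A.
Hypothesis m_le : forall n, (m n <= n)%N.
Hypothesis m_cvg : (m n)%:R / n%:R @[n --> \oo] --> u.

(** Each Gram entry is an average of a bounded function, so the law of large numbers with constant
    weight 1 applies to it. The finitely many entries are then jointly close to a matrix of nonzero
    determinant. *)
Lemma whp_empirical_moment_det p (phi : X -> 'cV[R]_p) :
  mxmeasurable phi -> (forall x i, `|phi x i 0| <= 1) ->
  \det (u *: moment_mx (Q true) phi + (1 - u) *: moment_mx (Q false) phi) != 0 ->
  whp Pr (fun n => [set w |
    \det (n%:R^-1 *: \sum_(k < n) phi (Xn k w) *m (phi (Xn k w))^T) != 0]).
Proof.
move=> mphi phi1 /det_neq0_near[e e0 He].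
set G := u *: _ + _ in He.
have lln (ij : 'I_p * 'I_p) : whp Pr (fun n => [set w |
    `|n%:R^-1 * \sum_(k < n) 1 * (phi (Xn k w) ij.1 0 * phi (Xn k w) ij.2 0)
      - G ij.1 ij.2| < e]).
  apply: (two_sample_lln Xn_indep Xn_law m_le
    (g := fun x => phi x ij.1 0 * phi x ij.2 0) _ _ (a := fun _ _ => 1)) => //.
  - exact: measurable_funM.
  - move=> b; apply: (@le_lt_trans _ _ 1%E); last exact: ltry.
    rewrite -(expectation_cst (Q b) 1); apply: expectation_le => //.
    + by apply: measurable_funX; exact: measurable_funM.
    + by move=> x; exact: sqr_ge0.
    + apply/aeW => x; rewrite -real_normK ?num_real// normrM.
      by rewrite expr_le1// ?mulr_ge0// mulr_ile1.
  - by move=> *; rewrite normr1.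
  - rewrite /G !mxE !mul1r; apply: cvgD; first exact: cvgMl.
    by apply: cvgMl; apply: cvgB => //; exact: cvg_cst.
apply: (whp_sub (whp_forall lln)) => [n|].
  have mdet : measurable_fun [set: Omega] (fun w =>
      \det (n%:R^-1 *: \sum_(k < n) phi (Xn k w) *m (phi (Xn k w))^T)).
    apply: measurable_det; apply: mxmeasurableZ => //; apply: mxmeasurable_sum => k.
    have mk : mxmeasurable (fun w => phi (Xn k w)).
      by move=> i j; exact: (measurableT_comp (mphi i j) (measurable_funPT (Xn k))).
    by apply: mxmeasurableM => //; exact: mxmeasurable_tr.
  rewrite (_ : [set _ | _] = [set w | 0 < `|\det (n%:R^-1 *: \sum_(k < n)
      phi (Xn k w) *m (phi (Xn k w))^T)|]); last first.
    by apply/seteqP; split=> w /=; rewrite normr_gt0.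
  by apply: measurable_set_ltr => //; exact: measurableT_comp.
apply: nearW => n w /= Hw; apply: He => i j; have := Hw (i, j).
by rewrite gramE/=; under eq_bigr do rewrite mul1r.
Qed.

Lemma whp_bridge (g : X -> R) (t : R) :
  measurable_fun [set: X] g ->
  (forall b, 'E_(Q b)[fun x => (g x ^+ 2)%R] < +oo)%E ->
  t < `|u * (1 - u) * (fine 'E_(Q true)[g]%E - fine 'E_(Q false)[g]%E)| ->
  whp Pr (fun n => [set w |
    t < `|n%:R^-1 * \sum_(k < n) bridge_weight R n (m n) (k < m n)%N * g (Xn k w)|]).
Proof.
move=> mg g2; set l := u * _ * _ => tl.
have e0 : 0 < `|l| - t by rewrite subr_gt0.
have r01 n : 0 <= ((m n)%:R / n%:R : R) <= 1.
  have [->|n0] := posnP n; first by rewrite invr0 mulr0 lexx ler01.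
  by rewrite divr_ge0//= ler_pdivrMr ?ltr0n// mul1r ler_nat.
apply: (whp_sub (two_sample_lln Xn_indep Xn_law m_le mg g2
  (a := fun n => bridge_weight R n (m n)) (l := l) _ _ e0)).
- move=> n b; have /andP[r0 r1] := r01 n; rewrite /bridge_weight.
  by case: b => /=; rewrite ler_norml; lra.
- set a := fine _; set b := fine _.
  (* The weights [1 - r] and [- r] occur with frequencies [r] and [1 - r], where [r = m n / n]; the
     mean is therefore [r (1 - r) (a - b)]. *)
  rewrite (_ : (fun n => _) = (fun n => (m n)%:R / n%:R * (1 - (m n)%:R / n%:R) * (a - b))).
    apply: cvgMl; apply: cvgM => //; apply: cvgB => //; exact: cvg_cst.
  by apply/funext => n; rewrite /bridge_weight/= mulr1n mulr0n; ring.
- move=> n; apply: measurable_set_ltr => //; apply: measurableT_comp => //.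
  apply: measurable_funM => //; apply: measurable_sum => k.
  by apply: measurable_funM => //; exact: measurableT_comp.
- apply: nearW => n w /=; set y := n%:R^-1 * _ => ly.
  have := ler_distD y l 0; rewrite subr0 subr0 distrC; lra.
Qed.

End random_sample.

Theorem theorem4p7 (R : realType) (d : nat)
  (* the parametric model *)
  (Theta : set 'cV[R]_d)
  (Theta_bounded : bounded_set Theta)
  (Theta_open : open Theta)
  (Theta_convex : convex_set Theta)
  (dX : measure_display) (X : measurableType dX)
  (mu : {measure set X -> \bar R})
  (P : 'cV[R]_d -> probability X R)
  (f : 'cV[R]_d -> X -> R)
  (P_density : forall theta, Theta theta -> is_density mu (P theta) (f theta))
  (psi : X -> 'cV[R]_d)
  (psi_meas : borel_measurable psi)
  (e_exists : forall theta, Theta theta -> forall i : 'I_d,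
     (P theta).-integrable [set: X] (fun x => (psi x i 0)%:E))
  (e_diff : forall theta, Theta theta ->
     differentiable (mean_vec P psi) theta)
  (* the observations under the alternative *)
  (ustar : R) (ustar01 : 0 < ustar < 1)
  (theta0 theta1 : 'cV[R]_d)
  (Theta_theta0 : Theta theta0) (Theta_theta1 : Theta theta1)
  (theta01 : theta0 <> theta1)
  (dO : measure_display) (Omega : measurableType dO)
  (Pr : probability Omega R)
  (Xn : forall n : nat, 'I_n -> {RV Pr >-> X})
  (Xn_indep : forall n : nat, mutually_independent (Xn n))
  (Xn_law : forall (n : nat) (k : 'I_n) (A : set X), measurable A ->
     distribution Pr (Xn n k) A =
     P (if (k < Num.truncn (ustar * n%:R))%N then theta0 else theta1) A)
  (* the method of moments estimator *)
  (theta_hat : nat -> Omega -> 'cV[R]_d)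
  (theta_hat_meas : forall n : nat, borel_measurable (theta_hat n))
  (theta_hat_Theta : forall (n : nat) (w : Omega), Theta (theta_hat n w))
  (theta_hat_sol : {ae Pr, forall w, \forall n \near \oo,
     Zn P psi (fun k : 'I_n => Xn n k w) 1 (theta_hat n w) = 0})
  (* the values of the inverse on the event that Sigma_hat is singular *)
  (W : nat -> Omega -> 'M[R]_d)
  (W_meas : forall n : nat, borel_measurable (W n))
  (* the assumptions of the theorem *)
  (psi_L2_0 : ('E_(P theta0)[fun x => (enorm (psi x) ^+ 2)%R] < +oo)%E)
  (psi_L2_1 : ('E_(P theta1)[fun x => (enorm (psi x) ^+ 2)%R] < +oo)%E)
  (Sigma_star : 'M[R]_d)
  (Sigma_starE : Sigma_star =
     ustar *: cov_mx P psi theta0 + (1 - ustar) *: cov_mx P psi theta1)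
  (Sigma_star_unit : Sigma_star \in unitmx)
  (lambda_star : R)
  (lambda_starE : smallest_eigenvalue (invmx Sigma_star) lambda_star)
  (lambda_star_gt0 : 0 < lambda_star)
  (e_neq : 0 < enorm (mean_vec P psi theta0 - mean_vec P psi theta1)) :
  forall c : R, 0 < c ->
    (fun n : nat =>
       Pr [set w | c < Tn P psi (W n w) (fun k : 'I_n => Xn n k w)
                         (theta_hat n w)])
      @ \oo --> 1%E.
Proof.
move=> c c0; have /andP[u0 u1] := ustar01.
have mpsi := borel_mxmeasurable psi_meas.
have mW n := borel_mxmeasurable (W_meas n).
(* The mean vector is continuous only on [Theta], by differentiability. As the estimator stays in
   [Theta], the preimage of a ray is the preimage of an open subset of [Theta]. *)
have mean_meas n : mxmeasurable (fun w => mean_vec P psi (theta_hat n w)).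
  move=> i j; rewrite ord1; apply: (measurability _ (RGenOInfty.measurableE R)) => //.
  move=> _ [_ [a ->] <-]; rewrite setTI.
  pose U := Theta `&` [set theta | a < mean_vec P psi theta i 0].
  have oU : open U.
    rewrite openE => theta [Ttheta ae].
    apply: filterI; first exact: open_nbhs_nbhs.
    have ct : {for theta, continuous (fun theta => mean_vec P psi theta i 0)}.
      apply: (@continuous_comp _ _ _ (mean_vec P psi) (fun M : 'cV[R]_d => M i 0)).
        exact/differentiable_continuous/e_diff.
      exact: coord_continuous.
    by apply: (ct [set y | a < y]); exact: lt_nbhsr.
  have := theta_hat_meas n measurableT U (sub_gen_smallest oU).
  rewrite setTI; congr measurable; apply/seteqP; split=> w /=; rewrite in_itv/= andbT.
    by move=> [].
  by move=> aw; split => //; exact: theta_hat_Theta.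
have mpsiX n (k : 'I_n) : mxmeasurable (fun w => psi (Xn n k w)).
  by move=> i j; exact: (measurableT_comp (mpsi i j) (measurable_funPT (Xn n k))).
have mT n : measurable [set w | c < Tn P psi (W n w) (fun k : 'I_n => Xn n k w)
                                        (theta_hat n w)].
  exact: measurable_Tn_gt.
(* [true] stands for the law before the change. *)
pose Q (b : bool) := P (if b then theta0 else theta1).
pose m n := Num.truncn (ustar * n%:R).
have mle n : (m n <= n)%N by apply: truncn_mul_le; exact: ltW.
have mcvg : (m n)%:R / n%:R @[n --> \oo] --> ustar.
  by apply: truncn_ratio_cvg; exact: ltW.
have psi2 b i : ('E_(Q b)[fun x => (psi x i 0 ^+ 2)%R] < +oo)%E.
  have enorm_sqr x : enorm (psi x) ^+ 2 = \sum_(j < d) psi x j 0 ^+ 2.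
    by rewrite sqr_sqrtr// sumr_ge0// => j _; exact: sqr_ge0.
  apply: (@le_lt_trans _ _ 'E_(Q b)[fun x => (enorm (psi x) ^+ 2)%R]%E); last first.
    by case: b.
  apply: expectation_le.
  - by apply: measurable_funX; exact: mpsi.
  - under eq_fun do rewrite enorm_sqr.
    by apply: measurable_sum => j; apply: measurable_funX; exact: mpsi.
  - by move=> x; exact: sqr_ge0.
  - by move=> x; exact: sqr_ge0.
  apply/aeW => x; rewrite enorm_sqr (bigD1 i)//= lerDl sumr_ge0// => j _.
  exact: sqr_ge0.
have psiL2 b i : (fun x => psi x i 0) \in Lfun (Q b) 2%:E.
  by apply: Lfun2_sqr_lty => //; exact: mpsi.
have [i ei] : exists i, mean_vec P psi theta0 i 0 != mean_vec P psi theta1 i 0.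
  apply/existsP; apply: contraTT e_neq; rewrite negb_exists => /forallP e01.
  rewrite /enorm big1 ?sqrtr0 ?ltxx// => j _.
  by have := e01 j; rewrite negbK => /eqP ej; rewrite mxE [X in _ + X]mxE ej subrr expr0n.
(* The limit of coordinate [i] of the recentred partial sum at the change point, nonzero by the
   choice of [i]. *)
pose l := ustar * (1 - ustar) *
  (fine 'E_(Q true)[fun x => (psi x i 0)%R]%E - fine 'E_(Q false)[fun x => (psi x i 0)%R]%E).
have l0 : l != 0.
  rewrite /l mulf_neq0//; last by move: ei; rewrite !mxE -subr_eq0.
  by rewrite mulf_neq0// gt_eqF// subr_gt0.
(* Half of the limit is exceeded with probability tending to 1, and [t ^+ 2 / c] is the matching
   level for the empirical second moment in [Tn_lower_bound]. *)
pose t := `|l| / 2.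
have t0 : 0 < t by rewrite divr_gt0 ?normr_gt0.
have tl : t < `|l| by rewrite /t ltr_pdivrMr// ltr_pMr ?normr_gt0// ltr1n.
have delta0 : 0 < t ^+ 2 / c by rewrite divr_gt0 ?exprn_gt0.
have whpB := whp_bridge (Q := Q) Xn_indep Xn_law mle mcvg (mpsi i 0) (psi2 ^~ i) tl.
have whpM := two_sample_sqr_tight (Q := Q) (m := m) Xn_law (mpsi i 0) (psi2 ^~ i) delta0.
have whpS := whp_empirical_moment_det (Q := Q) Xn_indep Xn_law mle mcvg
  (mxmeasurable_scaled_lift mpsi) (fun x => @scaled_lift_le1 _ _ (psi x))
  (moment_mix_det_neq0 ustar01 mpsi (psiL2 true) (psiL2 false)
    (eq_ind _ (fun S => S \in unitmx) Sigma_star_unit _ Sigma_starE)).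
have whpZ : whp Pr (fun n => [set w |
    Zn P psi (fun k : 'I_n => Xn n k w) 1 (theta_hat n w) = 0]).
  apply: whp_ae theta_hat_sol => n.
  have mZ : mxmeasurable (fun w => Zn P psi (fun k : 'I_n => Xn n k w) 1 (theta_hat n w)).
    apply: mxmeasurableZ => //; apply: mxmeasurable_sum => k.
    exact: mxmeasurableB.
  (* The estimating equation is expressed by one real inequality, a sum of squares not being
     positive, so that its measurability follows. *)
  rewrite [X in measurable X](_ : _ = ~` [set w | 0 < \sum_(j < d)
      Zn P psi (fun k : 'I_n => Xn n k w) 1 (theta_hat n w) j 0 ^+ 2]).
    apply: measurableC; apply: measurable_set_ltr => //.
    by apply: measurable_sum => j; apply: measurable_funX; exact: mZ.
  apply/seteqP; split=> w /=.
    by move=> ->; rewrite big1 ?ltxx// => j _; rewrite mxE expr0n.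
  move/negP; rewrite -leNgt => Zle0; apply/matrixP => j k; rewrite ord1 [RHS]mxE.
  apply: (sum_sqr_eq0 (u := fun j =>
    Zn P psi (fun k : 'I_n => Xn n k w) 1 (theta_hat n w) j 0)).
  by apply/eqP; rewrite eq_le Zle0 sumr_ge0// => k' _; exact: sqr_ge0.
apply: whp_cvg1; apply: (whp_sub (whpI (whpI whpB whpM) (whpI whpS whpZ))) => //.
near=> n; have n0 : (0 < n)%N by near: n; exact: nbhs_infty_gt.
move=> w [[/= tB QM] [/= detS Z0]].
apply: (Tn_lower_bound n0 (mle n) Z0 _ c0 t0 _ tB QM).
(* A singular [Sigma_hat] would make the Gram matrix of the [scaled_lift] vectors singular, the
   scale [s k] being their normalising factor. *)
apply: contraNT detS => /(@gram_affine_singular _ _ _ _ _ _ _ _ _) detS.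
apply/eqP; apply: detS.
by rewrite invr_gt0 ltr0n.
Unshelve. all: by end_near. Qed.
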